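(* The permutation statistic $\Psi : P \to \mathbb{Z}$ defined by $\Psi(\sigma) = \Lambda(\sigma)$ if $|\sigma| = 4$ and $\Psi(\sigma) = 1$ otherwise is not a descent statistic.
   Context: A permutation $\sigma = \sigma_1\sigma_2\cdots\sigma_n$ of size $|\sigma| = n$ is a finite sequence of $n$ distinct integers (not necessarily $1,\dots,n$). $P_n$ denotes the set of permutations of size $n$, and $P = \bigcup_n P_n$. Two permutations $\sigma, \phi$ of the same size are equivalent, written $\sigma\sim\phi$, if they have the same relative order, i.e. for all $i,j$, $\sigma_i < \sigma_j$ if and only if $\phi_i < \phi_j$. A function $st$ on $P$ is a permutation statistic if $st(\sigma) = st(\phi)$ whenever $\sigma\sim\phi$. The descent set of $\sigma\in P_n$ is $\mathrm{Des}(\sigma) = \{i \mid 1\le i<n,\ \sigma_i > \sigma_{i+1}\}$. A permutation statistic $st$ is a descent statistic if for every $n$ and all $\sigma,\phi\in P_n$, $\mathrm{Des}(\sigma)=\mathrm{Des}(\phi)$ implies $st(\sigma)=st(\phi)$. For a permutation $\sigma$ of size $4$ whose entries are $a_1<a_2<a_3<a_4$, define $\mathrm{Inv}_{12}(\sigma) = 1$ if $a_1$ appears to the left of $a_2$ in $\sigma$ and $\mathrm{Inv}_{12}(\sigma) = -1$ otherwise; define $\mathrm{Adj}_{34}(\sigma) = 1$ if $a_3$ and $a_4$ occupy adjacent positions in $\sigma$ (in either order) and $\mathrm{Adj}_{34}(\sigma) = -1$ otherwise; and set $\Lambda(\sigma) = \mathrm{Inv}_{12}(\sigma)\cdot \mathrm{Adj}_{34}(\sigma)$.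 *)

(* Defs.v *)
From HB Require Import structures.
From mathcomp Require Import all_boot all_order all_algebra.

Set Implicit Arguments.
Unset Strict Implicit.
Unset Printing Implicit Defensive.

Import Order.TTheory GRing.Theory Num.Theory.
Local Open Scope ring_scope.

Record permutation : Type := Permutation {
  entries :> seq int;
  _ : uniq entries
}.

HB.instance Definition _ := [isSub for entries].
HB.instance Definition _ := [Equality of permutation by <:].

(* The entry written $\sigma_i$, with positions i counted from 1, is s`_i.-1. *)

Definition perm_equiv (s t : permutation) : Prop :=
  size s = size t /\
  forall i j : nat, (1 <= i <= size s)%N -> (1 <= j <= size s)%N ->
    (s`_i.-1 < s`_j.-1 <-> t`_i.-1 < t`_j.-1).

Definition permutation_statistic (T : Type) (st : permutation -> T) : Prop :=
  forall s t : permutation, perm_equiv s t -> st s = st t.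

Definition Des (s : permutation) : {pred nat} :=
  [pred i : nat | (1 <= i < size s)%N && (s`_i.-1 > s`_i)].

Definition descent_statistic (T : Type) (st : permutation -> T) : Prop :=
  permutation_statistic st /\
  forall (n : nat) (s t : permutation), size s = n -> size t = n ->
    Des s =i Des t -> st s = st t.

(* The k-th smallest entry $a_k$, with k counted from 1. *)
Definition kth_smallest (s : permutation) (k : nat) : int :=
  (sort <=%O (entries s))`_k.-1.

Definition pos_of_kth (s : permutation) (k : nat) : nat :=
  index (kth_smallest s k) s.

(* Inv12, Adj34 and Lambda are meaningful only for permutations of size 4. *)
Definition Inv12 (s : permutation) : int :=
  if (pos_of_kth s 1 < pos_of_kth s 2)%N then 1 else -1.

Definition Adj34 (s : permutation) : int :=
  if (pos_of_kth s 4 == (pos_of_kth s 3).+1)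
     || (pos_of_kth s 3 == (pos_of_kth s 4).+1) then 1 else -1.

Definition Lambda (s : permutation) : int := Inv12 s * Adj34 s.

Definition Psi (s : permutation) : int :=
  if size s == 4 then Lambda s else 1.

(* Main.v *)
Require Import Defs.
From mathcomp Require Import all_boot all_order all_algebra.

(** [Psi] sees a permutation only through its size and the positions of its
    k-th smallest entries, and these positions depend on the relative order alone: when
    [s] and [t] are equivalent, [t] is the image of [s] under the order
    isomorphism [transport s t] that sends each entry of [s] to the entry of
    [t] in the same place.  An increasing map commutes with sorting, so it
    matches the k-th smallest entries while keeping positions; this is
    [pos_of_kth_equiv].

    On the other hand 1324 and 2314 both have descent set {2}.  In both of them
    3 and 4 are separated, but 1 precedes 2 only in the first, so [Psi] takes
    the values -1 and 1. *)

Set Implicit Arguments.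
Unset Strict Implicit.
Unset Printing Implicit Defensive.

Import Order.TTheory GRing.Theory Num.Theory.
Local Open Scope ring_scope.

Definition transport (s t : permutation) (x : int) : int := t`_(index x s).

Lemma uniq_entries (s : permutation) : uniq s.
Proof. exact: valP s. Qed.

Lemma map_transport (s t : permutation) :
  size s = size t -> map (transport s t) s = t.
Proof.
move=> eq_size; apply: (@eq_from_nth _ 0) => [|i]; rewrite size_map // => lt_i.
by rewrite (nth_map 0) // /transport index_uniq // uniq_entries.
Qed.

Lemma index_transport (s t : permutation) (x : int) :
  size s = size t -> x \in entries s -> index (transport s t x) t = index x s.
Proof.
by move=> eq_size s_x; rewrite index_uniq ?uniq_entries // -eq_size index_mem.
Qed.

Lemma transport_homo (s t : permutation) :
  perm_equiv s t ->
  {in entries s &, {homo transport s t : x y / x <= y}}.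
Proof.
case=> _ equiv_st x y s_x s_y; rewrite !le_eqVlt => /predU1P[-> | lt_xy].
  by rewrite eqxx.
have [| | lt_st _] := equiv_st (index x s).+1 (index y s).+1.
- by rewrite index_mem.
- by rewrite index_mem.
by rewrite /= !nth_index // in lt_st; rewrite [X in _ || X]lt_st ?orbT.
Qed.

Lemma sort_transport (s t : permutation) :
  perm_equiv s t ->
  sort <=%O (entries t) = map (transport s t) (sort <=%O (entries s)).
Proof.
move=> equiv_st; rewrite -{1}(map_transport (proj1 equiv_st)).
apply: (@homo_sort_map_in _ _ (mem (entries s))).
(* Antisymmetry along the transport is its injectivity: the common value has a
   single index in [t], which is also the index of both arguments in [s]. *)
- move=> x y s_x s_y /le_anti/(congr1 (index^~ (entries t))).
  rewrite !(index_transport (proj1 equiv_st)) //; exact: (index_inj 0).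
- by move=> y x z _ _ _; apply: le_trans.
- by move=> x y _ _; apply: le_total.
- exact: transport_homo.
- exact/allP.
Qed.

(** The upper bound on [k] matters: beyond [size s], [kth_smallest] is the
    default value 0, and whether and where 0 occurs as an entry is not determined
    by the relative order. *)
Lemma pos_of_kth_equiv (s t : permutation) (k : nat) :
  perm_equiv s t -> (1 <= k <= size s)%N -> pos_of_kth t k = pos_of_kth s k.
Proof.
move=> equiv_st; case: k => // k /= le_k.
have lt_k : (k < size (sort <=%O (entries s)))%N by rewrite size_sort.
rewrite /pos_of_kth /kth_smallest (sort_transport equiv_st) (nth_map 0) //.
apply: index_transport; first exact: (proj1 equiv_st).
by rewrite -(mem_sort <=%O) mem_nth.
Qed.

Lemma Psi_statistic : permutation_statistic Psi.
Proof.
move=> s t equiv_st; rewrite /Psi -(proj1 equiv_st).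
case: eqP => // size_s.
by rewrite /Lambda /Inv12 /Adj34 !(pos_of_kth_equiv equiv_st) ?size_s.
Qed.

Definition perm1324 : permutation := @Permutation [:: 1; 3; 2; 4] isT.
Definition perm2314 : permutation := @Permutation [:: 2; 3; 1; 4] isT.

Lemma Des1324_2314 : Des perm1324 =i Des perm2314.
Proof. by do 5?[case=> //]. Qed.

Theorem proposition1p4 :
  permutation_statistic Psi /\ ~ descent_statistic Psi.
Proof.
split; first exact: Psi_statistic.
(* The resulting equation computes to -1 = 1. *)
by case=> _ /(_ 4 perm1324 perm2314 erefl erefl Des1324_2314).
Qed.
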